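(* Let $h\ge 0$ and let $(G,D)$ be a finite $3$-transposition group of type $3^{\bullet h}{:}(2\times \operatorname{Sp}_{6}(2))$. Then the diagram of $(G,D)$ has size $n=63\cdot 3^{h}$ and spectrum $$((\,11\cdot 3^{h+1}-1;\ [5\cdot 3^h-1]^{27},\ [-3^{h+1}-1]^{35},\ [-1]^{\star}\,)).$$
   Context: A $3$-transposition group $(G,D)$ is a group $G$ generated by a conjugacy class $D$ of elements of order $2$ such that $|de|\in\{1,2,3\}$ for all $d,e\in D$. Its diagram is the graph with vertex set $D$ in which $d$ and $e$ are adjacent iff $|de|=3$; its size is $n=|D|$. The spectrum is that of the $(0,1)$-adjacency matrix, written $((k;\dots,[r]^c,\dots))$: first the degree $k$ of the (regular) diagram, counted once, then the remaining eigenvalues, $[r]^c$ meaning $r$ with multiplicity $c$; if listed values coincide, their multiplicities are added, and $[r]^\star$ means that $r$ has whatever further multiplicity (possibly zero) is required for the total multiplicity to be $n$. $\operatorname{Sp}_{6}(2)$ is the isometry group of a nondegenerate symplectic form on $\mathbb{F}_2^{6}$. $2\times\operatorname{Sp}_6(2)$, with the group of order $2$ generated by $z$, is taken with the $3$-transposition class $E=\{(z,t): t \text{ a symplectic transvection}\}$. $(G,D)$ has type $3^{\bullet h}{:}(2\times\operatorname{Sp}_6(2))$ if $G$ has a normal $3$-subgroup $N$ with $|D\cap dN|=3^h$ for all $d\in D$ and $(G/N,DN/N)\cong(2\times\operatorname{Sp}_6(2),E)$. *)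

(* Defs.v *)
From HB Require Import structures.
From mathcomp Require Import all_boot all_order all_fingroup all_algebra.
From mathcomp Require Import all_solvable all_field.

Set Implicit Arguments.
Unset Strict Implicit.
Unset Printing Implicit Defensive.

Import GRing.Theory.
Local Open Scope ring_scope.
Local Open Scope group_scope.

(** ** 3-transposition groups and their diagrams *)

Definition three_transposition_group (gT : finGroupType) (G : {group gT})
    (D : {set gT}) : Prop :=
  [/\ <<D>> = G,
      D \in classes G,
      forall d, d \in D -> #[d] = 2%N
    & forall d e, d \in D -> e \in D -> #[d * e] \in [:: 1; 2; 3]%N].

Definition diagram (gT : finGroupType) : rel gT := fun d e => #[d * e] == 3%N.

Definition diagram_regular (gT : finGroupType) (D : {set gT}) (k : nat) : Prop :=
  forall d, d \in D -> #|[set e in D | diagram d e]| = k.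

Definition diagram_mx (gT : finGroupType) (D : {set gT}) : 'M[algC]_#|D| :=
  \matrix_(i, j) (diagram (enum_val i) (enum_val j))%:R%R.

(* [s] lists the eigenvalues of [A], repeated according to multiplicity, in
   any order; coinciding values in [s] add up their multiplicities. *)
Definition has_spectrum (n : nat) (A : 'M[algC]_n) (s : seq algC) : Prop :=
  char_poly A = (\prod_(a <- s) ('X - a%:P))%R.

(* The diagram of [D] has spectrum ((k; [r_1]^c_1, ..., [r_m]^c_m, [r]^* )) with
   [l] = [:: (r_1, c_1); ...; (r_m, c_m)]. As [char_poly] has degree #|D|, the
   multiplicity [c] is forced to bring the total multiplicity to #|D|. *)
Definition diagram_spectrum (gT : finGroupType) (D : {set gT}) (k : nat)
    (l : seq (algC * nat)) (r : algC) : Prop :=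
  diagram_regular D k /\
  exists c : nat,
    has_spectrum (diagram_mx D)
      (k%:R%R :: flatten [seq nseq p.2 p.1 | p <- l] ++ nseq c r).

(** ** The group 2 x Sp_6(2) and its class E *)

Section Symplectic.

(* [is_psymplectic B], assumed where these definitions are used, says that [B]
   is nondegenerate and (the characteristic being 2) alternating. *)
Variable B : {skew_symmetric 'rV['F_2]_6}.

Definition Sp62 : {set {'GL_6['F_2]}} :=
  [set g : {'GL_6['F_2]} |
    [forall u : 'rV['F_2]_6, forall v : 'rV['F_2]_6,
       B (u *m GLval g)%R (v *m GLval g)%R == B u v]].

Lemma group_set_Sp62 : group_set Sp62.
Proof.
apply/group_setP; split=> [|g1 g2].
  rewrite inE; apply/forallP=> u; apply/forallP=> v.
  by rewrite GL_1E !mulmx1.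
rewrite !inE => /forallP Bg1 /forallP Bg2.
apply/forallP=> u; apply/forallP=> v; rewrite GL_MxE !mulmxA.
by rewrite (eqP (forallP (Bg2 _) _)) (forallP (Bg1 _)).
Qed.

Canonical Sp62_group := Group group_set_Sp62.

(* Over F_2 the only symplectic transvections are v |-> v + B(v, a) a, a <> 0:
   the scalar in the general form v |-> v + c B(v, a) a must be 1. *)
Definition Sp62_transvections : {set {'GL_6['F_2]}} :=
  [set t in Sp62 |
    [exists a : 'rV['F_2]_6, (a != 0%R) &&
       [forall v : 'rV['F_2]_6, (v *m GLval t == v + B v a *: a)%R]]].

(* The group of order 2 is the additive group 'Z_2, with generator z = Zp1. *)
Definition two_Sp62 : {set 'Z_2 * {'GL_6['F_2]}} := setX <[Zp1 : 'Z_2]> Sp62.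

Canonical two_Sp62_group := [group of two_Sp62].

Definition two_Sp62_class : {set 'Z_2 * {'GL_6['F_2]}} :=
  setX [set Zp1 : 'Z_2] Sp62_transvections.

End Symplectic.

(* Type 3^{.h} : (2 x Sp_6(2)); note that D / N is the image of D in G / N, that
   is, DN/N. *)
Definition has_type_3h_two_Sp62 (B : {skew_symmetric 'rV['F_2]_6}) (h : nat)
    (gT : finGroupType) (G : {group gT}) (D : {set gT}) : Prop :=
  exists N : {group gT},
    [/\ N <| G,
        3.-group N,
        forall d, d \in D -> #|D :&: d *: N| = (3 ^ h)%N
      & exists2 f : {morphism G / N >-> 'Z_2 * {'GL_6['F_2]}},
          isom (G / N) (two_Sp62 B) f & f @* (D / N) = two_Sp62_class B].

(* Main.v *)
(* The image of D in 2 x Sp_6(2) identifies D / N with the 63 transvections,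
   hence with the nonzero vectors a of F_2^6, the fibres of D -> D / N having
   q = 3^h elements. Two transpositions of the same fibre have a product in the
   3-group N, so they are adjacent as soon as they are distinct; transpositions
   of distinct fibres, over a and b, are adjacent iff their images do not
   commute, that is iff B(a, b) = 1. Writing A_0 for the adjacency matrix of the
   relation B(a, b) = 1 and U for the incidence matrix of the fibres, the
   adjacency matrix of the diagram is A = U (A_0 + I) U^T - I with U^T U = q I, so
   by Sylvester's determinant identity each eigenvalue t of A_0 gives q(t + 1) - 1
   and the remaining eigenvalues are -1. A character sum gives
   A_0^2 = 16 I + 16 J and A_0 J = 32 J, whence the spectrum 32, 4^27, (-4)^35 of
   A_0, using tr A_0 = 0. *)
Require Import Defs.
From mathcomp Require Import all_boot all_order all_fingroup all_algebra.
From mathcomp Require Import all_solvable all_field.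
From mathcomp Require Import ring zify.

Set Implicit Arguments.
Unset Strict Implicit.
Unset Printing Implicit Defensive.

Import GRing.Theory Num.Theory.
Local Open Scope ring_scope.

(** * Characteristic polynomials under affine change and blow-up *)

(* Both sides are the determinant of [[y, U], [V, 1]], times y ^ m, computed by
   clearing V with column, respectively row, operations. *)
Lemma det_scalar_sub_mulmxC (R : comPzRingType) (m n : nat)
    (U : 'M[R]_(n, m)) (V : 'M[R]_(m, n)) (y : R) :
  y ^+ m * \det (y%:M - U *m V) = y ^+ n * \det (y%:M - V *m U).
Proof.
pose X := block_mx y%:M U V 1%:M.
have detX : \det X = \det (y%:M - U *m V).
  have <- : \det (X *m block_mx 1%:M 0 (- V) 1%:M) = \det (y%:M - U *m V).
    rewrite mulmx_block !mulmx1 !mulmx0 !add0r mul1mx subrr mulmxN.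
    by rewrite det_ublock det1 mulr1.
  by rewrite det_mulmx det_lblock !det1 !mulr1.
have <- : \det (block_mx 1%:M 0 (- V) y%:M *m X) = y ^+ n * \det (y%:M - V *m U).
  rewrite mulmx_block !mul1mx !mul0mx !addr0 mulmx1 !mulNmx.
  rewrite mul_mx_scalar mul_scalar_mx addNr [- _ + _]addrC.
  by rewrite det_ublock det_scalar.
by rewrite det_mulmx det_lblock det1 mul1r det_scalar detX.
Qed.

(** With [z] = (X - d) / c, the matrix X - (cA + d) is c times X - A evaluated at [z]. The resulting
    factor c^n is shared among the n linear factors. *)
Lemma char_poly_affine (F : fieldType) (n : nat) (A : 'M[F]_n) (s : seq F)
    (c d : F) :
    c != 0 -> char_poly A = \prod_(a <- s) ('X - a%:P) ->
  char_poly (c *: A + d%:M) = \prod_(a <- s) ('X - (c * a + d)%:P).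
Proof.
move=> c_neq0 chA.
have size_s : size s = n.
  by apply/eqP; rewrite -eqSS -(size_char_poly A) chA size_prod_XsubC.
pose z : {poly F} := c^-1%:P * ('X - d%:P).
have cz : c%:P * z = 'X - d%:P.
  by rewrite mulrA -polyCM divff // mul1r.
have zE : char_poly_mx (c *: A + d%:M) =
    c%:P *: map_mx (comp_poly z) (char_poly_mx A).
  apply/matrixP=> i j; rewrite !mxE rmorphB rmorphMn /= comp_polyC comp_polyX.
  by rewrite polyCD polyCM mulrBr mulrnAr cz polyCMn; case: (i == j) => /=; ring.
rewrite /char_poly zE detZ det_map_mx -/(char_poly A) chA rmorph_prod /=.
rewrite -size_s; elim: s {chA size_s zE} => [|a s IHs]; first by rewrite !big_nil mul1r.
rewrite !big_cons -IHs /= exprS rmorphB /= comp_polyX comp_polyC mulrACA.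
by rewrite mulrBr cz -polyCM -addrA -opprD -polyCD [d + _]addrC.
Qed.

(** Since the matrix has the form C - 1, its characteristic polynomial is det(y - C) with y = X + 1.
    Moving [U^T] to the front turns C into q(A0 + 1), and cancelling y^m leaves the exponent n - m =
    m(q - 1). *)
Lemma char_poly_blowup (F : fieldType) (m n q : nat) (U : 'M[F]_(n, m))
    (A0 : 'M[F]_m) (s : seq F) :
    n = (m * q)%N -> (0 < q)%N -> q%:R != 0 :> F ->
    U^T *m U = q%:R%:M ->
    char_poly A0 = \prod_(a <- s) ('X - a%:P) ->
  char_poly (U *m (A0 + 1%:M) *m U^T - 1%:M) =
    \prod_(a <- s) ('X - (q%:R * (a + 1) - 1)%:P) * ('X + 1) ^+ (m * q.-1).
Proof.
move=> nE q_gt0 q_neq0 UTU chA0.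
pose y : {poly F} := 'X + 1.
have y_neq0 : y != 0 by rewrite /y -polyC1 -[1%:P]opprK -polyCN polyXsubC_eq0.
have chE k (C : 'M[F]_k) :
    char_poly (C - 1%:M) = \det (y%:M - map_mx polyC C).
  rewrite /char_poly /char_poly_mx map_mxB map_mx1 opprB addrA.
  by congr (\det (_ - _)); rewrite /y [RHS]raddfD.
rewrite chE map_mxM.
apply: (mulfI (expf_neq0 m y_neq0)).
rewrite det_scalar_sub_mulmxC -map_mxM mulmxA UTU mul_scalar_mx -chE.
have -> : q%:R *: (A0 + 1%:M) - 1%:M = q%:R *: A0 + (q%:R - 1)%:M.
  by rewrite scalerDr scalemx1 raddfB /= addrA.
rewrite (char_poly_affine _ q_neq0 chA0) mulrCA mulrC -exprD nE.
congr (_ * _ ^+ _); last by case: q q_gt0 {q_neq0 UTU nE} => // q _; rewrite mulnS.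
by apply: eq_bigr => a _; rewrite mulrDr mulr1 addrA.
Qed.

(** * Eigenvalue multiplicities from traces *)

Lemma perm_nseq3 (T : eqType) (a b c : T) (s : seq T) :
    uniq [:: a; b; c] -> {subset s <= [:: a; b; c]} ->
  perm_eq s (nseq (count_mem a s) a ++ nseq (count_mem b s) b
               ++ nseq (count_mem c s) c).
Proof.
rewrite /= !inE negb_or andbT => /andP[/andP[ab ac] bc] sabc.
apply/seq.permP=> p; rewrite !count_cat !count_nseq.
elim: s sabc => [|x s IHs] sabc /=; first by rewrite !muln0.
have {}IHs := IHs (fun y ys => sabc y (@mem_behead _ (x :: s) y ys)).
have := sabc x (mem_head x s); rewrite !inE IHs => /or3P[] /eqP->.
- by rewrite eqxx (negPf ab) (negPf ac); lia.
- by rewrite eqxx [b == a]eq_sym (negPf ab) (negPf bc); lia.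
- by rewrite eqxx [c == a]eq_sym [c == b]eq_sym (negPf ac) (negPf bc); lia.
Qed.

(* The multiplicities are determined by the size, the trace and the trace of the
   square. *)
Lemma char_poly_three_eigenvalues (n : nat) (A : 'M[algC]_n) :
    n = 63%N -> A \is normalmx -> \tr A = 0 -> \tr (A *m A) = 2016 ->
    (A - 32%:M) *m (A *m A - 16%:M) = 0 ->
  char_poly A = \prod_(a <- 32 :: nseq 27 4 ++ nseq 35 (- 4)) ('X - a%:P).
Proof.
move=> n63 /orthomx_spectralP; set P := spectralmx A; set sp := spectral_diag A.
have Pu : P \in unitmx by exact: spectral_unit.
move=> AE trA trA2 A0.
have conjM C C' : (invmx P *m C *m P) *m (invmx P *m C' *m P) = invmx P *m (C *m C') *m P.
  by rewrite !mulmxA mulmxK.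
have conjS a : a%:M = invmx P *m a%:M *m P.
  by rewrite mul_mx_scalar -scalemxAl mulVmx // scalemx1.
have trE C : \tr (invmx P *m C *m P) = \tr C by rewrite mxtrace_mulC mulmxA mulmxV ?mul1mx.
pose s := codom (sp 0).
have bigE (R : Type) (idx : R) (op : Monoid.com_law idx) (F : algC -> R) :
    \big[op/idx]_i F (sp 0 i) = \big[op/idx]_(a <- s) F a.
  by rewrite /s codomE big_map big_enum.
have sz : size s = 63%N by rewrite size_codom card_ord.
have chA : char_poly A = \prod_(a <- s) ('X - a%:P).
  rewrite -bigE; have <- : char_poly (diag_mx sp) = \prod_i ('X - (sp 0 i)%:P).
    rewrite char_poly_trig ?diag_mx_is_trig //.
    by apply: eq_bigr => i _; rewrite mxE eqxx.
  have PP : map_mx polyC (invmx P) *m map_mx polyC P = 1%:M.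
    by rewrite -map_mxM mulVmx // map_mx1.
  rewrite /char_poly; have -> : char_poly_mx A =
      map_mx polyC (invmx P) *m char_poly_mx (diag_mx sp) *m map_mx polyC P.
    rewrite /char_poly_mx mulmxBr mulmxBl mul_mx_scalar -scalemxAl PP scalemx1.
    by rewrite -!map_mxM -AE.
  by rewrite !det_mulmx mulrAC -det_mulmx PP det1 mul1r.
(* Conjugation by [P] makes the cubic relation diagonal, so it holds for each eigenvalue x: (x -
   32)(x^2 - 16) = 0. *)
have s3 : {subset s <= [:: 32; 4; -4]}.
  move=> _ /codomP[i ->]; rewrite !inE.
  have := A0; rewrite AE !conjM (conjS 32) (conjS 16) -!mulmxBl -!mulmxBr conjM.
  move/(congr1 (fun C => P *m C *m invmx P)).
  rewrite mulmx0 mul0mx !mulmxA mulmxV // mul1mx mulmxK //.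
  rewrite -!diag_const_mx mulmx_diag -!raddfB /= mulmx_diag.
  move/matrixP/(_ i i)/eqP; rewrite !mxE eqxx mulr1n mulf_eq0 !subr_eq0.
  have -> : 16 = 4 ^+ 2 :> algC by rewrite -natrX.
  by rewrite -expr2 eqf_sqr.
have s_uniq : uniq [:: 32; 4; -4 : algC].
  have n4 k : k.+1%:R == - 4 :> algC = false.
    by rewrite -addr_eq0 -natrD pnatr_eq0.
  by rewrite /= !inE !n4 eqr_nat.
have tr1 : \sum_(a <- s) a = 0.
  by rewrite -bigE -mxtrace_diag -trE -AE.
have tr2 : \sum_(a <- s) a ^+ 2 = 2016.
  rewrite -bigE; move: trA2; rewrite AE conjM trE mulmx_diag mxtrace_diag => <-.
  by apply: eq_bigr => i _; rewrite mxE expr2.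
rewrite chA; apply: perm_big.
have ps := perm_nseq3 s_uniq s3; move: (ps) sz tr1 tr2.
rewrite (perm_size ps) !(perm_big _ ps) /=.
rewrite !big_cat !big_nseq /= !size_cat !size_nseq !iter_addr_0 sqrrN -!natrX.
move: (count _ s) (count _ s) (count _ s) => c3 c2 c1 {}ps sz.
rewrite mulNrn addrA => /eqP; rewrite subr_eq0 -!mulrnA -!natrD eqr_nat => /eqP tr1.
move/eqP; rewrite eqr_nat => /eqP tr2.
(* The system is c1 + c2 + c3 = 63, 32 c1 + 4 c2 = 4 c3, 1024 c1 + 16 c2 + 16 c3 = 2016. *)
have [c1E c2E c3E] : [/\ c1 = 1, c2 = 27 & c3 = 35]%N by split; lia.
by move: ps; rewrite c1E c2E c3E.
Qed.

(** * The nontrivial additive character of F_2 *)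

Definition sgn_F2 (x : 'F_2) : algC := (-1) ^+ (x != 0).

Lemma F2_cases (x : 'F_2) : {x = 0} + {x = 1}.
Proof.
by case: x => [[|[|n]]] lt_n //; [left | right]; apply/val_inj.
Qed.

Lemma addvv_F2 (n : nat) (v : 'rV['F_2]_n) : v + v = 0.
Proof. by apply/rowP=> i; rewrite !mxE; case: (F2_cases (v 0 i)) => ->; apply/val_inj. Qed.

Lemma sgn_F2D : {morph sgn_F2 : x y / x + y >-> x * y}.
Proof.
have sgn0 : sgn_F2 0 = 1 by rewrite /sgn_F2 eqxx.
have sgn1 : sgn_F2 1 = -1 by [].
have add11 : 1 + 1 = 0 :> 'F_2 by apply/val_inj.
move=> x y; case: (F2_cases x) => ->; first by rewrite sgn0 add0r mul1r.
case: (F2_cases y) => ->; first by rewrite sgn0 addr0 mulr1.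
by rewrite add11 sgn1 mulrNN mulr1.
Qed.

Lemma neq0_sgn_F2 (x : 'F_2) : (x != 0)%:R = (1 - sgn_F2 x) / 2 :> algC.
Proof.
rewrite /sgn_F2; case: (x != 0) => /=; last by rewrite expr0 subrr mul0r.
by rewrite expr1 opprK -[1 + 1]/(2%:R) divff ?pnatr_eq0.
Qed.

(** * The graph of the form on nonzero vectors *)

Section SymplecticGraph.

Variable B : {skew_symmetric 'rV['F_2]_6}.
Hypothesis hB : is_psymplectic B.

Lemma psymplectic_alternating u : B u u = 0.
Proof. by case: hB => _ _; apply; rewrite pchar_Fp. Qed.

Lemma psymplectic_nondegenerate a : a != 0 -> exists c, B a c != 0.
Proof.
move=> a_neq0; case: hB => /eqP rad0 _ _.
have: a \notin orthov B fullv by rewrite rad0 memv0.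
by case/mem_orthovPn=> c _; exists c.
Qed.

(** If a is nonzero, translating c by a vector [c0] with B(a, c0) = 1 flips every sign, so the sum
    equals its own negative. *)
Lemma sum_sgn_form a : \sum_c sgn_F2 (B a c) = 64 * (a == 0)%:R.
Proof.
have [->|/psymplectic_nondegenerate[c0 Bc0]] := eqVneq a 0.
  under eq_bigr do rewrite linear0l /sgn_F2 eqxx expr0.
  by rewrite sumr_const card_mx card_Fp // mulr1.
rewrite mulr0; set S := \sum_c _.
suff /eqP: S + S = 0 by rewrite -mulr2n mulrn_eq0 => /eqP.
rewrite {1}/S (reindex_inj (addIr c0)) /= -big_split /= big1 // => c _.
by rewrite linearDr /= sgn_F2D /sgn_F2 Bc0 expr1 mulrN1 addNr.
Qed.

Lemma sum_form a : a != 0 -> \sum_c (B a c != 0)%:R = 32 :> algC.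
Proof.
move=> a_neq0; under eq_bigr do rewrite neq0_sgn_F2.
rewrite -mulr_suml sumrB sum_sgn_form (negPf a_neq0) mulr0 subr0.
rewrite sumr_const card_mx card_Fp //.
by rewrite -[(2 ^ (1 * 6))%N]/((32 * 2)%N) natrM mulfK ?pnatr_eq0.
Qed.

(* With chi x := (-1)^x, the summand is (1 - chi (B a c)) (1 - chi (B b c)) / 4,
   and chi (B a c) chi (B b c) = chi (B (a + b) c). *)
Lemma sum_form2 a b : a != 0 -> b != 0 ->
  \sum_c (B a c != 0)%:R * (B b c != 0)%:R = 16 + 16 * (a == b)%:R :> algC.
Proof.
move=> a_neq0 b_neq0.
transitivity (\sum_c (1 - sgn_F2 (B a c) - sgn_F2 (B b c) + sgn_F2 (B (a + b) c)) / 4).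
  apply: eq_bigr => c _; rewrite !neq0_sgn_F2 linearDl /= sgn_F2D.
  by field.
rewrite -mulr_suml big_split /= !sumrB !sum_sgn_form (negPf a_neq0) (negPf b_neq0).
rewrite sumr_const card_mx card_Fp // -[(2 ^ (1 * 6))%N]/64%N addr_eq0.
have -> : - b = b.
  by apply/eqP; rewrite eq_sym -subr_eq0 opprK addvv_F2.
have -> : 64 = 16 * 4 :> algC by rewrite -natrM.
by case: (a == b) => /=; field.
Qed.

(** The matrix A_0 of the overview; its graph is strongly regular with parameters (63, 32, 16,
    16). *)
Definition symplectic_mx : 'M[algC]_#|[set~ (0 : 'rV['F_2]_6)]| :=
  \matrix_(i, j) (B (enum_val i) (enum_val j) != 0)%:R.

Lemma card_nonzero : #|[set~ (0 : 'rV['F_2]_6)]| = 63%N.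
Proof. by rewrite cardsC1 card_mx card_Fp. Qed.

Lemma form_neq0C u v : (B u v != 0) = (B v u != 0).
Proof. by rewrite herm_eq0C. Qed.

Lemma enum_nonzero (i : 'I_#|[set~ (0 : 'rV['F_2]_6)]|) : enum_val i != 0.
Proof. by have := enum_valP i; rewrite !inE. Qed.

Lemma char_poly_symplectic_mx :
  char_poly symplectic_mx = \prod_(a <- 32 :: nseq 27 4 ++ nseq 35 (- 4)) ('X - a%:P).
Proof.
(* The zero vector contributes nothing, so sums over the vertices become sums over the whole space,
   where the character sums apply. *)
have sumE (F : 'rV['F_2]_6 -> algC) : F 0 = 0 ->
    \sum_(k < #|[set~ (0 : 'rV['F_2]_6)]|) F (enum_val k) = \sum_c F c.
  move=> F0; rewrite -big_enum_val [RHS](bigD1 0) //= F0 add0r.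
  by apply: eq_bigl => c; rewrite !inE.
have sq : symplectic_mx *m symplectic_mx = 16%:M + const_mx 16.
  apply/matrixP=> i j; rewrite !mxE.
  rewrite [RHS]addrC -[16 *+ (i == j)]mulr_natr -(inj_eq enum_val_inj) -sum_form2 ?enum_nonzero //.
  rewrite -sumE; last by rewrite linear0r eqxx mul0r.
  by apply: eq_bigr => k _; rewrite !mxE [in X in _ * X]form_neq0C.
apply: char_poly_three_eigenvalues.
- exact: card_nonzero.
- have adj : (symplectic_mx ^t* )%sesqui = symplectic_mx.
    by apply/matrixP=> i j; rewrite !mxE form_neq0C conj_natr.
  by apply/normalmxP; rewrite adj.
- by rewrite /mxtrace big1 // => i _; rewrite mxE psymplectic_alternating eqxx.
- rewrite sq /mxtrace; under eq_bigr do rewrite !mxE eqxx mulr1n -natrD.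
  by rewrite sumr_const card_ord card_nonzero -mulrnA.
(* The second factor is 16 J, which A_0 - 32 annihilates because every row of A_0 sums to 32. *)
- rewrite sq addrAC subrr add0r; apply/matrixP=> i j.
  rewrite mulmxBl mul_scalar_mx !mxE.
  under eq_bigr do rewrite !mxE.
  rewrite -mulr_suml (sumE (fun c => (B (enum_val i) c != 0)%:R)) ?sum_form ?enum_nonzero //.
    by rewrite subrr.
  by rewrite linear0r eqxx.
Qed.

End SymplecticGraph.

(** Entrywise form of the blow-up. [U] is the incidence matrix of the fibres of [r]; their common
    size q yields both n = mq and U^T U = q. *)
Lemma char_poly_blowup_fun (F : fieldType) (m n q : nat) (r : 'I_n -> 'I_m)
    (A0 : 'M[F]_m) (s : seq F) :
    (0 < q)%N -> q%:R != 0 :> F ->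
    (forall j, #|[set i | r i == j]| = q) ->
    char_poly A0 = \prod_(a <- s) ('X - a%:P) ->
  char_poly (\matrix_(i, k) (A0 (r i) (r k) + (r i == r k)%:R - (i == k)%:R)) =
    \prod_(a <- s) ('X - (q%:R * (a + 1) - 1)%:P) * ('X + 1) ^+ (m * q.-1).
Proof.
move=> q_gt0 q_neq0 rq chA0.
pose U : 'M[F]_(n, m) := \matrix_(i, j) (j == r i)%:R.
have nE : n = (m * q)%N.
  rewrite -[n]card_ord -sum1_card (partition_big r xpredT) //=.
  transitivity (\sum_(j < m) q)%N; last by rewrite sum_nat_const card_ord.
  by apply: eq_bigr => j _; rewrite sum1_card -(rq j); apply: eq_card => i; rewrite !inE.
have UE k (C : 'M_(m, k)) i l : (U *m C) i l = C (r i) l.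
  rewrite mxE (bigD1 (r i)) //= mxE eqxx mul1r big1 ?addr0 // => j /negPf jr.
  by rewrite mxE jr mul0r.
have UTE l (C : 'M_(l, m)) i k : (C *m U^T) i k = C i (r k).
  rewrite mxE (bigD1 (r k)) //= !mxE eqxx mulr1 big1 ?addr0 // => j /negPf jr.
  by rewrite !mxE jr mulr0.
rewrite -(char_poly_blowup (U := U) nE q_gt0 q_neq0 _ chA0).
  congr char_poly; apply/matrixP=> i k.
  by rewrite [RHS]mxE UTE UE !mxE.
apply/matrixP=> j l; rewrite !mxE.
under eq_bigr do rewrite !mxE.
rewrite (bigID (fun i => r i == j)) /= [X in _ + X]big1 ?addr0; last first.
  by move=> i /negPf rj; rewrite eq_sym rj mul0r.
transitivity (\sum_(i in [set i | r i == j]) (j == l)%:R : F).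
  apply: eq_big => [i|i /eqP->]; first by rewrite inE.
  by rewrite eqxx mul1r eq_sym.
by rewrite sumr_const rq; case: (j == l); rewrite ?mul0rn.
Qed.

Lemma card_enum_val (T : finType) (D : {set T}) (P : pred T) :
  #|[set i : 'I_#|D| | P (enum_val i)]| = #|[set d in D | P d]|.
Proof.
rewrite -sum1_card; under eq_bigl do rewrite inE.
rewrite -(big_enum_val_cond P (fun=> 1%N)).
by rewrite -sum1_card; apply: eq_bigl => d; rewrite inE.
Qed.

(** * Symplectic transvections and their centres *)

Section Transvections.

Variable B : {skew_symmetric 'rV['F_2]_6}.
Hypothesis hB : is_psymplectic B.

Definition is_transvection (a : 'rV['F_2]_6) (g : {'GL_6['F_2]}) :=
  forall v, v *m GLval g = v + B v a *: a.

Lemma form_eq1 u v : B u v != 0 -> B u v = 1.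
Proof. by case: (F2_cases (B u v)) => ->; rewrite ?eqxx. Qed.

Lemma transvection_ext a g g' :
  is_transvection a g -> is_transvection a g' -> g = g'.
Proof.
move=> ga ga'; apply/val_inj/row_matrixP=> i.
by rewrite !rowE [LHS]ga [RHS]ga'.
Qed.

(** The centre is the only nonzero displacement vg - v: a vector v with B(v, a) = 1 is displaced by
    a, and also by 0 or b. *)
Lemma transvection_center_inj a b g : a != 0 ->
  is_transvection a g -> is_transvection b g -> a = b.
Proof.
move=> /(psymplectic_nondegenerate hB)[v]; rewrite herm_eq0C => Bva ga gb.
have /addrI := etrans (esym (ga v)) (gb v).
rewrite (form_eq1 Bva) scale1r; have [->|/form_eq1->] := eqVneq (B v b) 0.
  by rewrite scale0r => a0; rewrite a0 linear0r eqxx in Bva.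
by rewrite scale1r.
Qed.

Lemma transvection_exists a : exists2 g, g \in Sp62 B & is_transvection a g.
Proof.
(* The column holds the values of B(-, a) on the standard basis, so its product with the row [a] is
   the rank-one map v |-> B(v, a) a. *)
pose T : 'M['F_2]_6 := 1%:M + (\col_i B (delta_mx 0 i) a) *m a.
have TE v : v *m T = v + B v a *: a.
  rewrite mulmxDr mulmx1 mulmxA; congr (_ + _).
  rewrite [v *m _]mx11_scalar mul_scalar_mx; congr (_ *: _).
  rewrite mxE {2}[v]row_sum_delta linear_sumlz /=.
  by apply: eq_bigr => i _; rewrite linearZl_LR /= mxE.
(* As B(a, a) = 0, applying [T] twice adds B(v, a) a twice, which is 0 in characteristic 2. Hence
   [T] is invertible. *)
have TT : T *m T = 1%:M.
  apply/row_matrixP=> i; rewrite !rowE mulmxA !TE mulmx1 linearDl /= linearZl_LR /=.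
  by rewrite (psymplectic_alternating hB) mulr0 addr0 -addrA addvv_F2 addr0.
have Tu : T \is a GRing.unit by have [] := mulmx1_unit TT.
exists (FinRing.Unit Tu) => //; rewrite inE; apply/forallP=> u; apply/forallP=> v.
rewrite /= !TE linearDl !linearDr /= !linearZl_LR !linearZr_LR /=.
rewrite (psymplectic_alternating hB) (hermC B a v) expr1 /=.
apply/eqP; ring.
Qed.

(** The two products differ only in the terms B(v, a) B(a, b) b and B(v, b) B(b, a) a. At v = a the
    first vanishes and the second is B(a, b)^2 a up to sign. *)
Lemma transvections_commuteE a b g g' :
    a != 0 -> is_transvection a g -> is_transvection b g' ->
  (g * g' == g' * g)%g = (B a b == 0).
Proof.
move=> a_neq0 ga gb.
have gg' v : v *m GLval (g * g')%g = v + B v b *: b + (B v a *: a + (B v a * B a b) *: b).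
  rewrite GL_MxE mulmxA ga gb linearDl /= linearZl_LR /= scalerDl.
  by rewrite addrACA.
have g'g v : v *m GLval (g' * g)%g = v + B v b *: b + (B v a *: a + (B v b * B b a) *: a).
  rewrite GL_MxE mulmxA gb ga linearDl /= linearZl_LR /= scalerDl.
  by rewrite addrA.
apply/eqP/idP=> [gC | /eqP Bab]; last first.
  apply/val_inj/row_matrixP=> i; rewrite !rowE gg' g'g.
  by rewrite Bab (hermC B b a) Bab /= !mulr0 !scale0r.
have := gg' a; rewrite gC g'g => /addrI/addrI.
rewrite (psymplectic_alternating hB) mul0r scale0r => /eqP.
by rewrite scaler_eq0 (negPf a_neq0) orbF mulf_eq0 [B b a == 0]herm_eq0C orbb.
Qed.

Lemma two_Sp62_classP x :
  reflect (exists2 a, a != 0 & x.1 = Zp1 /\ is_transvection a x.2)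
          (x \in two_Sp62_class B).
Proof.
case: x => z g; rewrite !inE /=; apply: (iffP idP).
  case/and3P=> /eqP-> _ /existsP[a /andP[a0 /forallP ga]].
  by exists a => //; split=> // v; apply/eqP.
case=> a a0 [-> ga]; rewrite eqxx /=; apply/andP; split.
  (* The formula determines g, so g is the isometry just constructed and lies in [Sp62]. *)
  have [g' g'S g'a] := transvection_exists a.
  by move: g'S; rewrite (transvection_ext ga g'a) inE.
by apply/existsP; exists a; rewrite a0; apply/forallP=> v; rewrite ga.
Qed.

End Transvections.

(** Two involutions commute iff the square of their product is 1; among the orders 1, 2, 3 only 3
    fails this. *)
Lemma diagram_commute (gT : finGroupType) (d e : gT) :
    #[d]%g = 2%N -> #[e]%g = 2%N -> #[d * e]%g \in [:: 1; 2; 3]%N ->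
  diagram d e = (d * e != e * d)%g.
Proof.
move=> od oe ode.
have inv2 x : #[x]%g = 2%N -> (x^-1 = x)%g.
  by move=> ox; apply/eqP; rewrite eq_invg_mul -expg2 -ox expg_order.
have -> : (d * e == e * d)%g = (#[d * e]%g %| 2)%N.
  by rewrite order_dvdn expg2 -eq_invg_mul invMg !inv2 // eq_sym.
by rewrite /diagram; move: ode; rewrite !inE => /or3P[] /eqP->.
Qed.

(** * From transpositions to centres of transvections *)

Section Quotient.

Variables (B : {skew_symmetric 'rV['F_2]_6}) (gT : finGroupType).
Variables (G N : {group gT}) (D : {set gT}).
Variable f : {morphism G / N >-> 'Z_2 * {'GL_6['F_2]}}%g.
Hypotheses (hB : is_psymplectic B) (hGD : three_transposition_group G D).
Hypotheses (nNG : (N <| G)%g) (pN : (3.-group N)%g).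
Hypotheses (isof : isom (G / N) (two_Sp62 B) f).
Hypothesis fD : (f @* (D / N) = two_Sp62_class B)%g.

Lemma transposition_normaliser d : d \in D -> d \in G /\ d \in 'N(N)%g.
Proof.
move=> dD; have dG : d \in G by case: hGD => <- _ _ _; apply: mem_gen.
by split=> //; apply: subsetP dG; apply: normal_norm.
Qed.

(** The centre of the transvection induced by [d]. The default 0 is never taken on [D], by
    [tcenterP]. *)
Definition tcenter (d : gT) : 'rV['F_2]_6 :=
  odflt 0 [pick a | (a != 0) &&
    [forall v, v *m GLval (f (coset N d)).2 == v + B v a *: a]].

Lemma tcenterP d : d \in D ->
  [/\ tcenter d != 0, (f (coset N d)).1 = Zp1
    & is_transvection B (tcenter d) (f (coset N d)).2].
Proof.
move=> dD; have [dG dN] := transposition_normaliser dD.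
have: f (coset N d) \in two_Sp62_class B.
  by rewrite -fD; apply: mem_morphim; [exact: mem_quotient | rewrite mem_morphim].
case/two_Sp62_classP=> // a a0 [f1 fa]; rewrite /tcenter; case: pickP => /= [b|].
  by case/andP=> b0 /forallP fb; split=> // v; apply/eqP.
move/(_ a); rewrite a0 /= => /forallP[] v; exact/eqP.
Qed.

Lemma coset_morph_inj d e : d \in D -> e \in D ->
  f (coset N d) = f (coset N e) -> coset N d = coset N e.
Proof.
move=> /transposition_normaliser[dG _] /transposition_normaliser[eG _].
by move/isom_inj/injmP: isof; apply; rewrite mem_quotient.
Qed.

(** The first component of the image is always [Zp1], so the centre determines the image under [f],
    and injectivity of [f] recovers the coset. *)
Lemma tcenter_eq d e : d \in D -> e \in D ->
  (tcenter d == tcenter e) = (e \in d *: N)%g.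
Proof.
move=> dD eD; have [dG dN] := transposition_normaliser dD.
have [eG eN] := transposition_normaliser eD.
have [d0 d1 d2] := tcenterP dD; have [e0 e1 e2] := tcenterP eD.
transitivity (coset N d == coset N e).
  apply/eqP/eqP=> [de | de].
    apply: (coset_morph_inj dD eD); apply: injective_projections; first by rewrite d1 e1.
    by rewrite de in d2; exact: transvection_ext d2 e2.
  by apply: (transvection_center_inj hB d0 d2); rewrite de.
rewrite -norm_rlcoset // eq_sym.
by apply/eqP/idP=> [/(rcoset_kercosetP eN dN) | /(rcoset_kercosetP eN dN)].
Qed.

(* Entrywise, A + I is the blow-up of A_0 + I along tcenter. *)
Lemma diagram_tcenter d e : d \in D -> e \in D ->
  ((d == e) + diagram d e =
     (tcenter d == tcenter e) + (B (tcenter d) (tcenter e) != 0%R))%N.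
Proof.
move=> dD eD; have [dG dN] := transposition_normaliser dD.
have [eG eN] := transposition_normaliser eD.
have [d0 d1 d2] := tcenterP dD; have [e0 e1 e2] := tcenterP eD.
case: hGD => _ _ ord2 /(_ _ _ dD eD) ordde.
have invD x : x \in D -> (x^-1 = x)%g.
  by move=> xD; apply/eqP; rewrite eq_invg_mul -expg2 -(ord2 x xD) expg_order.
have odiag := diagram_commute (ord2 d dD) (ord2 e eD) ordde.
have dV := invD d dD.
have eV := invD e eD.
have [tde | tde] := eqVneq (tcenter d) (tcenter e).
  rewrite tde (psymplectic_alternating hB) eqxx addn0 /=.
  have deN : (d * e)%g \in N.
    by move/eqP: tde; rewrite tcenter_eq // mem_lcoset dV.
  have [->|de] := eqVneq d e; first by rewrite /diagram -{1}eV mulVg order1.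
  have de1 : #[d * e]%g != 1%N by rewrite order_eq1 -eq_invg_mul dV.
  (* Elements of the 3-group [N] have order a power of 3. *)
  have de2 : #[d * e]%g != 2%N.
    by apply: contraTneq (mem_p_elt pN deN) => de2; rewrite /p_elt de2 pnatE.
  by move: ordde; rewrite /diagram !inE (negPf de1) (negPf de2) /= => ->.
have dNe : d != e by apply: contraNneq tde => ->.
rewrite (negPf dNe) /= !add0n; congr (nat_of_bool _).
have fM : (f (coset N d) * f (coset N e))%g = f (coset N (d * e)).
  by rewrite -morphM ?mem_quotient // -morphM.
have fM' : (f (coset N e) * f (coset N d))%g = f (coset N (e * d)).
  by rewrite -morphM ?mem_quotient // -morphM.
rewrite -(transvections_commuteE hB d0 d2 e2).
have -> : ((f (coset N d)).2 * (f (coset N e)).2 == (f (coset N e)).2 * (f (coset N d)).2)%g =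
   (f (coset N (d * e)) == f (coset N (e * d)))%g.
  rewrite -fM -fM'; apply/eqP/eqP=> [fC | /(congr1 snd) //].
  by apply: injective_projections => //; rewrite /= d1 e1.
apply/idP/idP => [odde|]; last first.
  by rewrite odiag; apply: contraNneq => ->.
(* If the images commuted, (de)^2 would lie in [N]. As de has order 3, (de)^2 is its inverse, so de
   would lie in [N] and the centres would agree. *)
apply: contraNneq tde => fC.
have deG : (d * e)%g \in G by rewrite groupM.
have edG : (e * d)%g \in G by rewrite groupM.
have cde : coset N (d * e) = coset N (e * d).
  by move/isom_inj/injmP: isof; apply; rewrite ?mem_quotient.
have sqN : ((d * e) ^+ 2)%g \in N.
  move/(rcoset_kercosetP (groupM dN eN) (groupM eN dN)): cde.
  by rewrite mem_rcoset invMg dV eV -expg2.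
rewrite tcenter_eq // mem_lcoset dV -[(d * e)%g]invgK groupV.
suff -> : ((d * e)^-1 = (d * e) ^+ 2)%g by [].
by apply/eqP; rewrite eq_invg_mul -expgS -(eqP odde) expg_order.
Qed.

(** Surjectivity onto the class provides some d in [D] with centre a; the fibre is then the
    intersection of [D] with dN. *)
Lemma card_tcenter_fibre q a :
    (forall d, d \in D -> #|D :&: (d *: N)%g| = q) -> a != 0 ->
  #|[set d in D | tcenter d == a]| = q.
Proof.
move=> fibq a_neq0; have [g _ ga] := transvection_exists hB a.
have: (Zp1, g) \in two_Sp62_class B by apply/two_Sp62_classP => //; exists a.
rewrite -fD => /morphimP[_ _ /morphimP[d dN dD ->] fd].
have [d0 d1 d2] := tcenterP dD.
have <- : tcenter d = a by apply: (transvection_center_inj hB d0 d2); rewrite -fd.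
rewrite -(fibq d dD); apply: eq_card => e; rewrite !inE.
by case eD: (e \in D) => //=; rewrite eq_sym tcenter_eq.
Qed.

End Quotient.

(** * Counting along fibres, and the spectrum of the diagram *)

Lemma sum_fibre (T S : finType) (D : {set T}) (W : {set S}) (phi : T -> S)
    (q : nat) (F : S -> nat) :
    {in D, forall d, phi d \in W} ->
    {in W, forall a, #|[set d in D | phi d == a]| = q} ->
  (\sum_(d in D) F (phi d) = q * \sum_(a in W) F a)%N.
Proof.
move=> phiW fibq; rewrite (partition_big phi (mem W)) //= big_distrr /=.
apply: eq_bigr => a aW; rewrite -(fibq a aW) -sum1_card big_distrl /=.
by apply: eq_big => [d|d /andP[_ /eqP->]]; rewrite ?inE ?mul1n.
Qed.

Theorem proposition6p9 (B : {skew_symmetric 'rV['F_2]_6})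
    (hB : is_psymplectic B) (h : nat) (gT : finGroupType) (G : {group gT})
    (D : {set gT}) (hGD : three_transposition_group G D)
    (htype : has_type_3h_two_Sp62 B h G D) :
  #|D| = (63 * 3 ^ h)%N /\
  diagram_spectrum D (11 * 3 ^ (h + 1) - 1)%N
    [:: (5 * 3 ^+ h - 1, 27%N); (- 3 ^+ (h + 1) - 1, 35%N)] (-1).
Proof.
case: htype => N [nNG pN fibD [f isof fD]].
set q := (3 ^ h)%N in fibD; have q_gt0 : (0 < q)%N by rewrite expn_gt0.
set W := [set~ (0 : 'rV['F_2]_6)].
pose c := tcenter B f; have [d0 d0D] : exists d, d \in D.
  by case: hGD => _ /imsetP[d dG ->] _ _; exists d; apply: class_refl.
have cW : {in D, forall d, c d \in W}.
  by move=> d dD; rewrite !inE; have [] := tcenterP hB hGD nNG fD dD.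
have fibW : {in W, forall a, #|[set d in D | c d == a]| = q}.
  move=> a; rewrite !inE => a_neq0.
  exact: (card_tcenter_fibre hB hGD nNG isof fD).
have adjE d e : d \in D -> e \in D ->
    ((d == e) + diagram d e = (c d == c e) + (B (c d) (c e) != 0%R))%N.
  exact: (diagram_tcenter hB hGD nNG pN isof fD).
have cardD : #|D| = (63 * q)%N.
  rewrite -sum1_card (sum_fibre (fun=> 1%N) cW fibW) sum1_card card_nonzero.
  by rewrite mulnC.
split=> //; split.
  (* Counting d along with its neighbours gives q(1 + 32): one fibre over the centre of d and 32
     over the centres not orthogonal to it. *)
  move=> d dD; have : (\sum_(e in D) ((d == e) + diagram d e) = 33 * q)%N.
    under eq_bigr => e eD do rewrite adjE //.
    rewrite (sum_fibre (fun a => (c d == a) + (B (c d) a != 0%R))%N cW fibW).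
    rewrite mulnC; congr (_ * _)%N; rewrite big_split /=.
    rewrite (bigD1 (c d)) ?cW //= eqxx big1 ?addn0; last first.
      by move=> a /andP[_ /negPf]; rewrite eq_sym => ->.
    congr S; apply/eqP; rewrite -(eqr_nat algC) natr_sum.
    rewrite -[X in _ == X](sum_form hB (a := c d)); last by have := cW d dD; rewrite !inE.
    rewrite [X in _ == X](bigD1 0) //= linear0r eqxx add0r.
    by apply/eqP/eq_bigl => a; rewrite !inE.
  rewrite big_split /= (bigD1 d) //= eqxx big1 ?addn0; last first.
    by move=> e /andP[_ /negPf]; rewrite eq_sym => ->.
  have -> : (\sum_(e in D) diagram d e = #|[set e in D | diagram d e]|)%N.
    rewrite -sum1_card [RHS](eq_bigl (fun e => (e \in D) && diagram d e)).
      by rewrite big_mkcondr.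
    by move=> e; rewrite inE.
  by rewrite addn1 expnS mulnA -/q => <-; rewrite addnC addnK.
(* The blow-up adds n - 63 = 63(q - 1) eigenvalues -1, none when h = 0. *)
exists (63 * q.-1)%N; rewrite /has_spectrum.
have cWi (i : 'I_#|D|) : c (enum_val i) \in W by apply: cW; apply: enum_valP.
(* [r] is the centre map [c] rewritten on matrix indices. *)
have [r rE] : {r : 'I_#|D| -> 'I_#|W| | forall i, enum_val (r i) = c (enum_val i)}.
  by exists (fun i => enum_rank_in (cWi i) (c (enum_val i))) => i; rewrite enum_rankK_in.
have rE2 i j : (r i == j) = (c (enum_val i) == enum_val j).
  by rewrite -(inj_eq enum_val_inj) rE.
have diagE : diagram_mx D = \matrix_(i, k)
    (symplectic_mx B (r i) (r k) + (r i == r k)%:R - (i == k)%:R).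
  apply/matrixP=> i k.
 rewrite [LHS]mxE.
 rewrite [RHS]mxE.
 rewrite [symplectic_mx _ _ _]mxE.
 rewrite (rE i) (rE k).
 rewrite rE2 (rE k).
  have /(congr1 (fun n => n%:R : algC)) := adjE _ _ (enum_valP i) (enum_valP k).
  rewrite !natrD (inj_eq enum_val_inj) => adj.
  by apply/eqP; rewrite eq_sym subr_eq addrC -adj addrC.
rewrite diagE (char_poly_blowup_fun q_gt0 _ _ (char_poly_symplectic_mx hB)).
- have flE (x y : algC) m n :
      flatten [seq nseq p.2 p.1 | p <- [:: (x, m); (y, n)]] = nseq m x ++ nseq n y.
    by rewrite /= cats0.
  rewrite card_nonzero flE [in LHS]big_cons [in LHS]big_cat [in RHS]big_cons 2![in RHS]big_cat.
  rewrite !big_nseq !iter_mulr_1.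
  (* The eigenvalues 32, 4, -4 of A_0 become 33q - 1, 5q - 1 and -3q - 1; the first is the
     degree. *)
  have -> : q%:R * (32 + 1) - 1 = (11 * 3 ^ (h + 1) - 1)%:R :> algC.
    by rewrite natrB ?muln_gt0 ?expn_gt0 // addn1 expnS mulnA natrM mulrC natr1.
  have -> : q%:R * (4 + 1) - 1 = 5 * 3 ^+ h - 1 :> algC.
    by rewrite natrX mulrC natr1.
  have -> : q%:R * (- 4 + 1) - 1 = - 3 ^+ (h + 1) - 1 :> algC.
    by rewrite natrX addn1 exprS; ring.
  have -> : 'X + 1 = 'X - (- 1)%:P :> {poly algC} by rewrite polyCN polyC1 opprK.
  by rewrite -[LHS]mulrA.
- by rewrite pnatr_eq0 -lt0n.
- move=> j; rewrite -(fibW (enum_val j) (enum_valP j)) -card_enum_val.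
  by apply: eq_card => i; rewrite !inE rE2.
Qed.
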